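(* Let $(G,E,\varphi)$ be a self-similar graph action. Then the inverse semigroup $\mathcal{S}_{G,E}$ is strongly E*-unitary if and only if $(G,E,\varphi)$ is pseudo-free.
   Context: **Graphs.** A directed graph is $E=(E^0,E^1,r,d)$ with vertex set $E^0$, edge set $E^1$ and maps $r,d:E^1\to E^0$. A vertex $x$ is a source if $r^{-1}(x)=\emptyset$ and a sink if $d^{-1}(x)=\emptyset$. For $n\ge 2$, $E^n=\{x_1\cdots x_n : x_i\in E^1,\ d(x_i)=r(x_{i+1})\}$, and $E^*=\bigcup_{n\ge 0}E^n$ is the set of finite paths (vertices are paths of length $0$). For $\alpha=x_1\cdots x_n$, $r(\alpha)=r(x_1)$ and $d(\alpha)=d(x_n)$; for a vertex $x$, $r(x)=d(x)=x$. Paths $\alpha,\beta$ may be concatenated to $\alpha\beta$ when $d(\alpha)=r(\beta)$, with $r(\alpha)\alpha=\alpha=\alpha d(\alpha)$. An automorphism of $E$ is a bijection of $E^0\cup E^1$ preserving $E^0$ and $E^1$ and commuting with $r$ and $d$. **Self-similar graph actions.** A self-similar graph action $(G,E,\varphi)$ consists of a finite directed graph $E$ with no sources or sinks, a countable discrete group $G$ acting on $E$ by graph automorphisms, and a map $\varphi:G\times E^1\to G$ such that $\varphi(gh,e)=\varphi(g,he)\varphi(h,e)$ and $\varphi(g,e)x=gx$ for all $g,h\in G$, $e\in E^1$, $x\in E^0$. The action and $\varphi$ extend to $E^*$ (length-preservingly) by $\varphi(g,x)=g$ for $x\in E^0$, and $g(\alpha\beta)=(g\alpha)(\varphi(g,\alpha)\beta)$,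 $\varphi(g,\alpha\beta)=\varphi(\varphi(g,\alpha),\beta)$ for $\alpha,\beta\in E^*$ with $d(\alpha)=r(\beta)$. **Pseudo-free.** $(G,E,\varphi)$ is pseudo-free if whenever $g\in G$ and $e\in E^1$ satisfy $ge=e$ and $\varphi(g,e)=1$, then $g=1$. **The inverse semigroup.** $\mathcal{S}_{G,E}=\{(\alpha,g,\beta)\in E^*\times G\times E^* : d(\alpha)=g\,d(\beta)\}\cup\{0\}$, with zero element $0$, involution $(\alpha,g,\beta)^*=(\beta,g^{-1},\alpha)$, and product $$(\alpha,g,\beta)(\gamma,h,\nu)=\begin{cases}(\alpha\, g\gamma',\ \varphi(g,\gamma')h,\ \nu) & \text{if }\gamma=\beta\gamma',\\ (\alpha,\ g\,\varphi(h^{-1},\beta')^{-1},\ \nu\, h^{-1}\beta') & \text{if }\beta=\gamma\beta',\\ 0 & \text{otherwise.}\end{cases}$$ **Strongly E*-unitary.** For an inverse semigroup $\mathcal{S}$ with zero, let $E(\mathcal{S})$ be its set of idempotents. A prehomomorphism from $\mathcal{S}$ to a group $H$ is a function $\theta:\mathcal{S}\setminus\{0\}\to H$ such that $\theta(st)=\theta(s)\theta(t)$ whenever $st\ne 0$. It is idempotent pure if $\theta^{-1}(1)=E(\mathcal{S})\setminus\{0\}$. $\mathcal{S}$ is strongly E*-unitary if there is an idempotent pure prehomomorphism from $\mathcal{S}$ to some group. *)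

(* Defs.v *)
From HB Require Import structures.
From mathcomp Require Import all_boot.

Set Implicit Arguments.
Unset Strict Implicit.
Unset Printing Implicit Defensive.

Local Open Scope group_scope.

#[short(type="countGroupType")]
HB.structure Definition CountGroup := {G of Group G & Countable G}.

Bind Scope group_scope with CountGroup.sort.

(* The inverse of [s] is characterized, as usual, by [s s* s = s] and
   [s* s s* = s*]; given such a map [star], commutation of the idempotents is
   equivalent to uniqueness of inverses (see [star_uniq]). *)
HB.mixin Record Semigroup_isInverse0 S of Semigroup S := {
  szero : S;
  star : S -> S;
  szeroM : left_zero szero (@mul S);
  szeroMr : right_zero szero (@mul S);
  mulsVs : forall s : S, s * star s * s = s;
  mulVsV : forall s : S, star s * s * star s = star s;
  idemC : forall e f : S, e * e = e -> f * f = f -> e * f = f * e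
}.

#[short(type="inverseSemigroup0Type")]
HB.structure Definition InverseSemigroup0 :=
  {S of Semigroup S & Semigroup_isInverse0 S}.

Bind Scope group_scope with InverseSemigroup0.sort.

Lemma star_uniq (S : inverseSemigroup0Type) (s t : S) :
  s * t * s = s -> t * s * t = t -> t = star s.
Proof.
move=> sts tst.
have i1 : s * t * (s * t) = s * t by rewrite mulgA sts.
have i2 : s * star s * (s * star s) = s * star s by rewrite mulgA mulsVs.
have i3 : t * s * (t * s) = t * s by rewrite mulgA tst.
have i4 : star s * s * (star s * s) = star s * s by rewrite mulgA mulVsV.
have st : s * t = s * star s.
  rewrite -[in LHS](mulsVs s) -(mulgA _ s t) (idemC _ _ i2 i1).
  by rewrite mulgA sts.
have ts : t * s = star s * s.
  rewrite -[in LHS](mulsVs s) -(mulgA s) (mulgA t) (idemC _ _ i3 i4).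
  by rewrite -mulgA (mulgA s) sts.
by rewrite -tst ts -mulgA st mulgA mulVsV.
Qed.

Section EstarUnitary.

Variable S : inverseSemigroup0Type.

Definition idempotent (s : S) : Prop := s * s = s.

(* A function on [S \ {0}] is represented by a function on [S] whose value at
   [0] is irrelevant. *)
Definition prehomomorphism (H : groupType) (theta : S -> H) : Prop :=
  forall s t : S, s * t <> szero -> theta (s * t) = theta s * theta t.

Definition idempotent_pure (H : groupType) (theta : S -> H) : Prop :=
  forall s : S, s <> szero -> (theta s = 1 <-> idempotent s).

Definition strongly_Estar_unitary : Prop :=
  exists (H : groupType) (theta : S -> H),
    prehomomorphism theta /\ idempotent_pure theta.

End EstarUnitary.

Record digraph := Digraph {
  vertex : finType;
  edge : finType;
  edge_r : edge -> vertex;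
  edge_d : edge -> vertex
}.

Section Graph.

Variable E : digraph.

Definition is_source (x : vertex E) : Prop := @edge_r E @^-1: [set x] = set0.
Definition is_sink (x : vertex E) : Prop := @edge_d E @^-1: [set x] = set0.

Definition is_graph_automorphism
    (fV : vertex E -> vertex E) (fE : edge E -> edge E) : Prop :=
  [/\ bijective fV, bijective fE,
      forall e, edge_r (fE e) = fV (edge_r e)
    & forall e, edge_d (fE e) = fV (edge_d e)].

(* [(x, [:: e1; ...; en])] represents the path [e1 ... en] with [r(e1) = x]
   if [n > 0], and the vertex [x] (a path of length 0) if [n = 0]. *)
Definition raw_path : Type := (vertex E * seq (edge E))%type.

Fixpoint chain (x : vertex E) (s : seq (edge E)) : bool :=
  if s is e :: s' then (edge_r e == x) && chain (edge_d e) s' else true.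

Record fpath := FPath {
  raw_of :> raw_path;
  fpath_chain : chain raw_of.1 raw_of.2
}.

HB.instance Definition _ := [isSub for raw_of].
HB.instance Definition _ := [Countable of fpath by <:].

Definition path_r (a : fpath) : vertex E := (raw_of a).1.
Definition path_edges (a : fpath) : seq (edge E) := (raw_of a).2.
Definition path_d (a : fpath) : vertex E :=
  last (path_r a) (map (@edge_d E) (path_edges a)).

Definition vpath (x : vertex E) : fpath := @FPath (x, [::]) isT.

Fact epath_subproof (e : edge E) : chain (edge_r e) [:: e].
Proof. by rewrite /= eqxx. Qed.

Definition epath (e : edge E) : fpath := @FPath (_, _) (epath_subproof e).

(* Concatenation is meaningful only when [path_d a = path_r b]; the default
   value used otherwise is irrelevant. *)
Definition path_cat (a b : fpath) : fpath :=
  insubd a (path_r a, path_edges a ++ path_edges b).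

(* [path_quo a c] is [Some b] if [c = ab], and [None] if there is no such [b];
   see [path_quoP]. *)
Definition path_quo (a c : fpath) : option fpath :=
  if (path_r a == path_r c) && prefix (path_edges a) (path_edges c)
  then insub (path_d a, drop (size (path_edges a)) (path_edges c))
  else None.

Lemma chain_cat x s t :
  chain x (s ++ t) = chain x s && chain (last x (map (@edge_d E) s)) t.
Proof. by elim: s x => //= e s IHs x; rewrite IHs andbA. Qed.

Lemma path_catE a b : path_d a = path_r b ->
  raw_of (path_cat a b) = (path_r a, path_edges a ++ path_edges b).
Proof.
move=> ab; rewrite [LHS]val_insubd /= chain_cat.
case: a b ab => -[x s] /= cs [[y t] ct]; rewrite /path_d /path_r /= => ->.
by rewrite cs ct.
Qed.

Lemma path_d_cat a b : path_d a = path_r b -> path_d (path_cat a b) = path_d b.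
Proof.
move=> ab; rewrite {1}/path_d /path_r /path_edges path_catE //=.
by rewrite map_cat last_cat; congr last.
Qed.

Lemma path_r_cat a b : path_d a = path_r b -> path_r (path_cat a b) = path_r a.
Proof. by move=> ab; rewrite {1}/path_r path_catE. Qed.

Lemma path_edges_cat a b : path_d a = path_r b ->
  path_edges (path_cat a b) = path_edges a ++ path_edges b.
Proof. by move=> ab; rewrite {1}/path_edges path_catE. Qed.

Lemma path_quoP a c b :
  path_quo a c = Some b <-> path_d a = path_r b /\ c = path_cat a b.
Proof.
rewrite /path_quo; split.
  case: ifP => // /andP[/eqP rac /prefixP[t ct]] qb.
  have {qb} : raw_of b = (path_d a, t).
    case: insubP qb => // u _ uE [<-]; rewrite [LHS]uE.
    by rewrite ct drop_size_cat.
  move=> bE; have ab : path_d a = path_r b by rewrite /path_r bE.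
  split=> //; apply: val_inj; rewrite [RHS]path_catE // rac.
  by rewrite {2}/path_edges bE -ct /path_r /path_edges /=; case: (raw_of c).
case=> ab ->.
rewrite path_r_cat // path_edges_cat // eqxx prefix_prefix drop_size_cat //= ab.
by rewrite -[(_, _)]surjective_pairing -[raw_of b]/(val b) valK.
Qed.

Lemma path_quo_None a c : path_quo a c = None <->
  ~ exists b, path_d a = path_r b /\ c = path_cat a b.
Proof.
split=> [qN [b /path_quoP]|nex]; first by rewrite qN.
by case qE: (path_quo a c) => [b|] //; case: nex; exists b; apply/path_quoP.
Qed.

End Graph.

Record self_similar_action (G : countGroupType) (E : digraph) :=
  SelfSimilarAction {
  vact : G -> vertex E -> vertex E;
  eact : G -> edge E -> edge E;
  phi : G -> edge E -> G;
  no_source : forall x : vertex E, ~ is_source x;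
  no_sink : forall x : vertex E, ~ is_sink x;
  act_aut : forall g, is_graph_automorphism (vact g) (eact g);
  vact1 : forall x, vact 1 x = x;
  vactM : forall g h x, vact (g * h) x = vact g (vact h x);
  eact1 : forall e, eact 1 e = e;
  eactM : forall g h e, eact (g * h) e = eact g (eact h e);
  phiM : forall g h e, phi (g * h) e = phi g (eact h e) * phi h e;
  vact_phi : forall g e x, vact (phi g e) x = vact g x
}.

Section SelfSimilar.

Variables (G : countGroupType) (E : digraph) (A : self_similar_action G E).

Definition pseudo_free : Prop :=
  forall (g : G) (e : edge E), eact A g e = e -> phi A g e = 1 -> g = 1.

Fixpoint seq_act (g : G) (s : seq (edge E)) : seq (edge E) :=
  if s is e :: s' then eact A g e :: seq_act (phi A g e) s' else [::].

Fixpoint seq_phi (g : G) (s : seq (edge E)) : G :=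
  if s is e :: s' then seq_phi (phi A g e) s' else g.

Lemma chain_act g x s : chain x s -> chain (vact A g x) (seq_act g s).
Proof.
elim: s g x => //= e s IHs g x /andP[/eqP <- /(IHs (phi A g e))].
by have [_ _ -> ->] := act_aut A g; rewrite eqxx vact_phi.
Qed.

(* The extensions of the action and of [phi] to finite paths; the lemmas
   [path_act_cat] and [path_phi_cat] below give the recursion rules for
   arbitrary concatenations. *)
Definition path_act (g : G) (a : fpath E) : fpath E :=
  @FPath E (vact A g (path_r a), seq_act g (path_edges a))
           (chain_act g (fpath_chain a)).

Definition path_phi (g : G) (a : fpath E) : G := seq_phi g (path_edges a).

Lemma seq_act_cat g s t :
  seq_act g (s ++ t) = seq_act g s ++ seq_act (seq_phi g s) t.
Proof. by elim: s g => //= e s IHs g; rewrite IHs. Qed.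

Lemma seq_phi_cat g s t : seq_phi g (s ++ t) = seq_phi (seq_phi g s) t.
Proof. by elim: s g => //=. Qed.

Lemma size_seq_act g s : size (seq_act g s) = size s.
Proof. by elim: s g => //= e s IHs g; rewrite IHs. Qed.

Lemma vact_seq_phi g s x : vact A (seq_phi g s) x = vact A g x.
Proof. by elim: s g => //= e s IHs g; rewrite IHs vact_phi. Qed.

Lemma path_r_act g a : path_r (path_act g a) = vact A g (path_r a).
Proof. by []. Qed.

Lemma path_d_act g a : path_d (path_act g a) = vact A g (path_d a).
Proof.
rewrite /path_d path_r_act; set x := path_r a; clearbody x.
rewrite {1}/path_edges /=; elim: (path_edges a) g x => //= e s IHs g x.
by have [_ _ _ ->] := act_aut A g; rewrite -(vact_phi A g e) IHs vact_phi.
Qed.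

Lemma path_act_vertex g x : path_act g (vpath x) = vpath (vact A g x).
Proof. exact: val_inj. Qed.

Lemma path_phi_vertex g x : path_phi g (vpath x) = g.
Proof. by []. Qed.

Lemma path_act_edge g e : path_act g (epath e) = epath (eact A g e).
Proof.
by apply: val_inj; rewrite /= /path_r /=; have [_ _ -> _] := act_aut A g.
Qed.

Lemma path_phi_edge g e : path_phi g (epath e) = phi A g e.
Proof. by []. Qed.

Lemma path_act_cat g a b : path_d a = path_r b ->
  path_act g (path_cat a b) = path_cat (path_act g a) (path_act (path_phi g a) b).
Proof.
move=> ab; apply: val_inj; rewrite [RHS]path_catE; last first.
  by rewrite path_d_act path_r_act vact_seq_phi ab.
by rewrite /= path_r_cat // path_edges_cat // seq_act_cat.
Qed.

Lemma path_phi_cat g a b : path_d a = path_r b ->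
  path_phi g (path_cat a b) = path_phi (path_phi g a) b.
Proof. by move=> ab; rewrite /path_phi path_edges_cat // seq_phi_cat. Qed.

Definition in_SGE (t : fpath E * G * fpath E) : bool :=
  path_d t.1.1 == vact A t.1.2 (path_d t.2).

Record triple := Triple {
  triple_val : fpath E * G * fpath E;
  tripleP : in_SGE triple_val
}.

HB.instance Definition _ := [isSub for triple_val].
HB.instance Definition _ := [Countable of triple by <:].

(* [None] is the zero element. *)
Definition SGE : Type := option triple.

HB.instance Definition _ := Countable.on SGE.

(* The triples given to [insub] below always satisfy [in_SGE], so that [insub]
   never yields [None]: see [SGE_mul_r], [SGE_mul_l] and [SGE_starE]. *)
Definition SGE_star (s : SGE) : SGE :=
  if s is Some (Triple (a, g, b) _) then insub (b, g^-1, a) else None.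

Definition SGE_mul (s t : SGE) : SGE :=
  match s, t with
  | Some (Triple (a, g, b) _), Some (Triple (c, h, n) _) =>
      if path_quo b c is Some c' then
        insub (path_cat a (path_act g c'), path_phi g c' * h, n)
      else if path_quo c b is Some b' then
        insub (a, g * (path_phi h^-1 b')^-1, path_cat n (path_act h^-1 b'))
      else None
  | _, _ => None
  end.

Lemma vactK g x y : x = vact A g y -> y = vact A g^-1 x.
Proof. by move->; rewrite -vactM mulVg vact1. Qed.

Lemma in_mul_r a g b c' h n : in_SGE (a, g, b) -> path_d b = path_r c' ->
    in_SGE (path_cat b c', h, n) ->
  in_SGE (path_cat a (path_act g c'), path_phi g c' * h, n).
Proof.
rewrite /in_SGE /= => /eqP abE bc'; rewrite path_d_cat // => /eqP cE.
rewrite path_d_cat ?path_r_act ?abE ?bc' // path_d_act cE.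
by rewrite vactM vact_seq_phi.
Qed.

Lemma in_mul_l a g c b' h n : in_SGE (a, g, path_cat c b') ->
    path_d c = path_r b' -> in_SGE (c, h, n) ->
  in_SGE (a, g * (path_phi h^-1 b')^-1, path_cat n (path_act h^-1 b')).
Proof.
rewrite /in_SGE /= => /eqP abE cb' /eqP /vactK nE.
rewrite path_d_cat // in abE.
rewrite path_d_cat ?path_r_act ?nE ?cb' // path_d_act vactM abE.
apply/eqP; congr (vact A g _).
by rewrite -(vact_seq_phi h^-1 (path_edges b')) -vactM mulVg vact1.
Qed.

Lemma in_star a g b : in_SGE (a, g, b) -> in_SGE (b, g^-1, a).
Proof. by rewrite /in_SGE /= => /eqP /vactK ->. Qed.

Lemma SGE_mul_r a g b c' h n (p : in_SGE (a, g, b)) (bc' : path_d b = path_r c')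
    (q : in_SGE (path_cat b c', h, n)) :
  SGE_mul (Some (Triple p)) (Some (Triple q)) =
  Some (Triple (in_mul_r p bc' q)).
Proof.
have /path_quoP qE : path_d b = path_r c' /\ path_cat b c' = path_cat b c' by [].
rewrite /= qE; exact: (valK (Triple (in_mul_r p bc' q))).
Qed.

Lemma path_cat_vertex (a b : fpath E) : path_d a = path_r b ->
  path_edges b = [::] -> path_cat a b = a.
Proof.
move=> ab b0; apply: val_inj; rewrite [LHS]path_catE // b0 cats0.
by rewrite /= /path_r /path_edges; case: (raw_of a).
Qed.

Lemma path_cat_inj (a b c : fpath E) : path_d a = path_r b ->
  path_d a = path_r c -> path_cat a b = path_cat a c -> b = c.
Proof.
move=> ab ac bc; apply: Some_inj.
have /path_quoP <- : path_d a = path_r b /\ path_cat a c = path_cat a b by [].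
by apply/path_quoP.
Qed.

Lemma path_quoE (a c : fpath E) : isSome (path_quo a c) =
  (path_r a == path_r c) && prefix (path_edges a) (path_edges c).
Proof.
rewrite /path_quo; case: ifP => // /andP[/eqP rac /prefixP[t ct]].
rewrite insubT //= ct drop_size_cat //.
have := fpath_chain c; rewrite -/(path_r c) -/(path_edges c) ct -rac chain_cat.
by case/andP.
Qed.

Lemma phi1 e : phi A 1 e = 1.
Proof.
by apply: (mulgI (phi A 1 e)); rewrite mulg1 -[in RHS](mulg1 1) phiM eact1.
Qed.

Lemma seq_act1 s : seq_act 1 s = s.
Proof. by elim: s => //= e s IHs; rewrite eact1 phi1 IHs. Qed.

Lemma seq_phi1 s : seq_phi 1 s = 1.
Proof. by elim: s => //= e s IHs; rewrite phi1. Qed.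

Lemma seq_actM g h s : seq_act (g * h) s = seq_act g (seq_act h s).
Proof. by elim: s g h => //= e s IHs g h; rewrite eactM phiM IHs. Qed.

Lemma seq_phiM g h s : seq_phi (g * h) s = seq_phi g (seq_act h s) * seq_phi h s.
Proof. by elim: s g h => //= e s IHs g h; rewrite phiM IHs. Qed.

Lemma seq_actK g : cancel (seq_act g) (seq_act g^-1).
Proof. by move=> s; rewrite -seq_actM mulVg seq_act1. Qed.

Lemma seq_actVK g : cancel (seq_act g^-1) (seq_act g).
Proof. by move=> s; rewrite -seq_actM mulgV seq_act1. Qed.

Lemma seq_phiV g s : seq_phi g (seq_act g^-1 s) = (seq_phi g^-1 s)^-1.
Proof.
by apply: (mulIg (seq_phi g^-1 s)); rewrite -seq_phiM mulgV seq_phi1 mulVg.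
Qed.

Lemma prefix_act h s w : prefix (seq_act h^-1 s) w = prefix s (seq_act h w).
Proof.
apply/prefixP/prefixP => [[t ->]|[t wE]].
  by rewrite seq_act_cat seq_actVK; eexists.
by rewrite -(seq_actK h w) wE seq_act_cat; eexists.
Qed.

(* [SGE] acts by partial bijections on the pairs formed of a path and an
   element of [G]; this action is faithful and turns products into composites,
   whence the inverse semigroup laws. *)
Definition triple_act (t : fpath E * G * fpath E) (x : raw_path E * G) :
    option (raw_path E * G) :=
  let: (a, g, b) := t in
  if (path_r b == x.1.1) && prefix (path_edges b) x.1.2 then
    let w := drop (size (path_edges b)) x.1.2 in
    Some ((path_r a, path_edges a ++ seq_act g w), seq_phi g w * x.2)
  else None.

Definition SGE_act (s : SGE) (x : raw_path E * G) : option (raw_path E * G) :=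
  if s is Some t then triple_act (val t) x else None.

Lemma triple_act_cat a g b w k :
  triple_act (a, g, b) ((path_r b, path_edges b ++ w), k) =
  Some ((path_r a, path_edges a ++ seq_act g w), seq_phi g w * k).
Proof. by rewrite /= eqxx prefix_prefix drop_size_cat. Qed.

Lemma triple_actP a g b x y : triple_act (a, g, b) x = Some y ->
  exists2 w, x = ((path_r b, path_edges b ++ w), x.2) &
    y = ((path_r a, path_edges a ++ seq_act g w), seq_phi g w * x.2).
Proof.
case: x => -[x u] k /=; case: ifP => // /andP[/eqP <- /prefixP[w ->]] [<-].
by exists w => //; rewrite drop_size_cat.
Qed.

Lemma SGE_act_inj s t : SGE_act s =1 SGE_act t -> s = t.
Proof.
have one (r : triple) : SGE_act (Some r) (val (val r).2, 1) =
    Some (val (val r).1.1, (val r).1.2).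
  case: r => -[[a g] b] p /=.
  have -> : raw_of b = (path_r b, path_edges b ++ [::]).
    by rewrite cats0 [LHS]surjective_pairing.
  rewrite [LHS]triple_act_cat /= cats0 mulg1.
  by rewrite [in RHS](surjective_pairing (raw_of a)).
case: s => [s|]; case: t => [t|] //= st.
- case: s st => -[[a g] b] p; case: t => -[[c h] n] q st.
  have e1 : triple_act (a, g, b) (raw_of n, 1) = Some (raw_of c, h).
    exact: (etrans (st _) (one (Triple q))).
  have e2 : triple_act (c, h, n) (raw_of b, 1) = Some (raw_of a, g).
    exact: (etrans (esym (st _)) (one (Triple p))).
  have [v [nE] _] := triple_actP e1; have [w [bE] [aE gE]] := triple_actP e2.
  have [rb sb] : path_r b = path_r n /\ path_edges b = path_edges n ++ w.
    by rewrite {1}/path_r {1}/path_edges; split; have := bE => /= ->.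
  have sn : path_edges n = path_edges b ++ v.
    by rewrite {1}/path_edges; have := nE => /= ->.
  have [ra sa] : path_r a = path_r c /\
      path_edges a = path_edges c ++ seq_act h w.
    by rewrite {1}/path_r {1}/path_edges; split; have := aE => /= ->.
  have w0 : w = [::].
    apply: size0nil; have := congr1 size sb; have := congr1 size sn.
    rewrite !size_cat => -> /eqP.
    by rewrite -addnA -[X in X == _]addn0 eqn_add2l eq_sym addn_eq0 => /andP[_ /eqP].
  rewrite w0 cats0 in sb; rewrite w0 /= mulg1 in gE; rewrite w0 cats0 in sa.
  have fpathP (u v' : fpath E) : path_r u = path_r v' ->
      path_edges u = path_edges v' -> u = v'.
    move=> uv1 uv2; apply: val_inj.
    by rewrite [LHS]surjective_pairing [RHS]surjective_pairing; congr pair.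
  have bn : b = n by apply: fpathP.
  have ac : a = c by apply: fpathP.
  by congr Some; apply: val_inj; rewrite /= ac bn -gE.
- by have := one s; rewrite st.
- by have := one t; rewrite -st.
Qed.

Lemma SGE_starE a g b (p : in_SGE (a, g, b)) :
  SGE_star (Some (Triple p)) = Some (Triple (in_star p)).
Proof. exact: (valK (Triple (in_star p))). Qed.

Lemma SGE_mul_l a g b' c h n (p : in_SGE (a, g, path_cat c b'))
    (cb' : path_d c = path_r b') (q : in_SGE (c, h, n)) :
  SGE_mul (Some (Triple p)) (Some (Triple q)) =
  Some (Triple (in_mul_l p cb' q)).
Proof.
have /path_quoP qE : path_d c = path_r b' /\ path_cat c b' = path_cat c b' by [].
rewrite /=; case cE: (path_quo _ c) => [c'|]; last first.
  rewrite qE; exact: (valK (Triple (in_mul_l p cb' q))).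
have /path_quoP[bc' ccE] := cE.
have /eqP := congr1 (fun x => size (path_edges x)) ccE.
rewrite path_edges_cat // path_edges_cat // !size_cat -addnA.
rewrite -[X in X == _]addn0 eqn_add2l eq_sym addn_eq0 !size_eq0.
case/andP=> /eqP b0 /eqP c0.
have /eqP pE := p; have /eqP /vactK qE' := q.
cbn in pE, qE'; have := pE; rewrite path_d_cat // => pE'.
have -> : path_cat a (path_act g c') = a.
  by rewrite path_cat_vertex /path_edges //= ?c0 // path_r_act -bc' pE.
have nE : path_cat n (path_act h^-1 b') = n.
  by rewrite path_cat_vertex /path_edges //= ?b0 // path_r_act -cb' qE'.
have eE : (a, path_phi g c' * h, n) =
    (a, g * (path_phi h^-1 b')^-1, path_cat n (path_act h^-1 b')).
  by rewrite nE /path_phi b0 c0 /= invgK.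
rewrite eE; exact: (valK (Triple (in_mul_l p cb' q))).
Qed.

Lemma SGE_mul_0 a g b c h n (p : in_SGE (a, g, b)) (q : in_SGE (c, h, n)) :
    ~ (exists c', path_d b = path_r c' /\ c = path_cat b c') ->
    ~ (exists b', path_d c = path_r b' /\ b = path_cat c b') ->
  SGE_mul (Some (Triple p)) (Some (Triple q)) = None.
Proof. by move=> /path_quo_None /= -> /path_quo_None ->. Qed.

Lemma prefix_cat2 (T : eqType) (s u v : seq T) :
  prefix (s ++ u) (s ++ v) = prefix u v.
Proof. by elim: s => //= x s IHs; rewrite eqxx. Qed.

Lemma SGE_actM s t x :
  SGE_act (SGE_mul s t) x = obind (SGE_act s) (SGE_act t x).
Proof.
case: s => [[[[a g] b] p]|]; last by case: (SGE_act t x).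
case: t => [[[[c h] n] q]|] //.
case cE: (path_quo b c) => [c'|].
  have /path_quoP[bc' cE'] := cE; subst c; rewrite SGE_mul_r.
  have pE : path_d a = path_r (path_act g c').
    by move: (eqP p); rewrite /= bc' path_r_act.
  cbn [SGE_act val isSub.val_subdef triple_val].
  case tx: (triple_act (path_cat b c', h, n) x) => [y|]; last first.
    by move: tx => /=; case: ifP.
  have [w -> ->] := triple_actP tx; cbn [obind oapp].
  rewrite !path_edges_cat // !path_r_cat // -catA.
  rewrite [RHS]triple_act_cat triple_act_cat path_edges_cat // path_r_cat //.
  by rewrite seq_act_cat seq_actM seq_phi_cat catA mulgA seq_phiM.
case bE: (path_quo c b) => [b'|].
  have /path_quoP[cb' bE'] := bE; subst b; rewrite SGE_mul_l.
  have qE : path_d n = path_r (path_act h^-1 b').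
    by rewrite path_r_act -cb'; apply: vactK (eqP q).
  cbn [SGE_act val isSub.val_subdef triple_val].
  case tx: (triple_act (c, h, n) x) => [y|]; last first.
    rewrite /= path_r_cat // path_edges_cat //; case: ifP => // /andP[rx].
    case/prefixP=> w xE; move: tx => /=; rewrite rx xE -catA prefix_prefix.
    by [].
  have [w -> ->] := triple_actP tx; cbn [obind oapp].
  rewrite /= !path_edges_cat // !path_r_cat // !eqxx !prefix_cat2.
  rewrite prefix_act; case: ifP => // /prefixP[v wE].
  rewrite -[w](seq_actK h) wE !seq_act_cat seq_actVK seq_phi_cat seq_phiV.
  rewrite !catA !drop_size_cat ?size_cat //.
  by rewrite seq_actM seq_phiM mulgA.
have -> : SGE_mul (Some (Triple p)) (Some (Triple q)) = None.
  by rewrite /= cE bE.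
cbn [SGE_act val isSub.val_subdef triple_val].
case tx: (triple_act (c, h, n) x) => [y|] //.
have [w _ ->] := triple_actP tx; rewrite /=.
case: ifP => // /andP[/eqP rbc /prefixP[v vE]].
have := path_quoE b c; have := path_quoE c b.
rewrite cE bE rbc eqxx /= !prefixE.
case: (leqP (size (path_edges b)) (size (path_edges c))) => [le|/ltnW le] H1 H2.
  have := congr1 (take (size (path_edges b))) vE.
  by rewrite !takel_cat // take_size => cb; rewrite cb eqxx in H2.
have := congr1 (take (size (path_edges c))) vE.
by rewrite !takel_cat // take_size => cb; rewrite -cb eqxx in H1.
Qed.

Lemma SGE_act_star s x y : SGE_act s x = Some y -> SGE_act (SGE_star s) y = Some x.
Proof.
case: s => [[[[a g] b] p]|] // sx; rewrite SGE_starE.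
have [w -> ->] := triple_actP sx.
rewrite [LHS]triple_act_cat seq_actK; congr (Some (_, _)).
by rewrite mulgA -seq_phiM mulVg seq_phi1 mul1g.
Qed.

Lemma SGE_starK : involutive SGE_star.
Proof.
case=> [[[[a g] b] p]|] //; rewrite !SGE_starE; congr Some.
by apply: val_inj; rewrite /= invgK.
Qed.

Lemma SGE_mulA : associative SGE_mul.
Proof.
move=> s t u; apply: SGE_act_inj => x; rewrite !SGE_actM.
by case: (SGE_act u x) => //= y; rewrite SGE_actM.
Qed.

Lemma SGE_mul0 : left_zero (None : SGE) SGE_mul.
Proof. by []. Qed.

Lemma SGE_mul0r : right_zero (None : SGE) SGE_mul.
Proof. by case=> [[[[a g] b] p]|]. Qed.

Lemma SGE_mulsVs s : SGE_mul (SGE_mul s (SGE_star s)) s = s.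
Proof.
apply: SGE_act_inj => x; rewrite SGE_actM.
case sx: (SGE_act s x) => [y|] //=.
by rewrite SGE_actM (SGE_act_star sx).
Qed.

Lemma SGE_mulVsV s :
  SGE_mul (SGE_mul (SGE_star s) s) (SGE_star s) = SGE_star s.
Proof. by have := SGE_mulsVs (SGE_star s); rewrite SGE_starK. Qed.

Lemma SGE_idem_act e x y : SGE_mul e e = e -> SGE_act e x = Some y -> x = y.
Proof.
move=> ee ex; have := SGE_actM e e x; rewrite ee ex /= => /esym ey.
by have := SGE_act_star ey; rewrite (SGE_act_star ex) => -[].
Qed.

Lemma SGE_idemC e f : SGE_mul e e = e -> SGE_mul f f = f ->
  SGE_mul e f = SGE_mul f e.
Proof.
move=> ee ff; apply: SGE_act_inj => x; rewrite !SGE_actM.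
case fx: (SGE_act f x) => [y|]; case ex: (SGE_act e x) => [z|] //=.
- have fy := SGE_idem_act ff fx; have ez := SGE_idem_act ee ex.
  by subst y z; rewrite fx ex.
- by have fy := SGE_idem_act ff fx; subst y; rewrite ex.
- by have ez := SGE_idem_act ee ex; subst z; rewrite fx.
Qed.

HB.instance Definition _ := isSemigroup.Build SGE SGE_mulA.
HB.instance Definition _ := Semigroup_isInverse0.Build SGE
  SGE_mul0 SGE_mul0r SGE_mulsVs SGE_mulVsV SGE_idemC.

End SelfSimilar.

(* Main.v *)
(** If [g e = e] and [phi(g, e) = 1], then [(r(e), g, r(e)) (e, 1, e) = (e, 1, e)],
    so an idempotent pure prehomomorphism forces [(r(e), g, r(e))] to be
    idempotent, that is [g = 1].

    Conversely, [theta (a, g, b) = a g b^-1] is a prehomomorphism into any group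
    that contains images of [G] and of the edges, with [g e = (g e) phi(g, e)].
    Such a group is realized by permutations of
    [Omega = (words in E^1 x G) + (G x nat)], where [G] acts on words by [A] and
    on the rest by translations.  Pseudo-freeness makes this action free, as
    well as the action [(e, x) |-> (g e, phi(g, e) x)] on [E^1 x Omega]; hence an
    equivariant Cantor-Bernstein argument extends the maps
    [(w, k) |-> (e w, k)] to permutations [T_e] of [Omega] with
    [g T_e = T_(g e) phi(g, e)].  As [T_w g] maps [([::], 1)] to [(w, g)], the
    equality [a g = b] in this group forces [a = b] as words and [g = 1]. *)
From HB Require Import structures.
From mathcomp Require Import all_boot boolp.
Require Import Defs.

Set Implicit Arguments.
Unset Strict Implicit.
Unset Printing Implicit Defensive.

Local Open Scope group_scope.

(** * The group of permutations of a type *)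

Record symm (T : Type) := Symm {
  symm_fun :> T -> T;
  symm_inv : T -> T;
  symm_funK : cancel symm_fun symm_inv;
  symm_invK : cancel symm_inv symm_fun
}.

Section SymmetricGroup.

Variable T : Type.

Implicit Types p q : symm T.

Lemma symm_ext p q : p =1 q -> p = q.
Proof.
case: p q => [f f' fK f'K] [g g' gK g'K] /= /funext fg; subst g.
have ffg : f' = g' by apply/funext => x; rewrite -[in LHS](g'K x) fK.
by subst g'; congr Symm; apply: Prop_irrelevance.
Qed.

HB.instance Definition _ := gen_eqMixin (symm T).
HB.instance Definition _ := gen_choiceMixin (symm T).

Definition symm_one : symm T := @Symm T id id (frefl _) (frefl _).
Definition symm_mul p q : symm T :=
  Symm (can_comp (symm_funK p) (symm_funK q))
       (can_comp (symm_invK q) (symm_invK p)).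
Definition symm_opp p : symm T := Symm (symm_invK p) (symm_funK p).

Lemma symm_mulA : associative symm_mul.
Proof. by move=> p q r; apply: symm_ext. Qed.

Lemma symm_mul1 : left_id symm_one symm_mul.
Proof. by move=> p; apply: symm_ext. Qed.

Lemma symm_mulr1 : right_id symm_one symm_mul.
Proof. by move=> p; apply: symm_ext. Qed.

Lemma symm_mulV : left_inverse symm_one symm_opp symm_mul.
Proof. by move=> p; apply: symm_ext => x /=; rewrite symm_funK. Qed.

Lemma symm_mulVr : right_inverse symm_one symm_opp symm_mul.
Proof. by move=> p; apply: symm_ext => x /=; rewrite symm_invK. Qed.

HB.instance Definition _ := isGroup.Build (symm T)
  symm_mulA symm_mul1 symm_mulr1 symm_mulV symm_mulVr.

Lemma symmM p q x : (p * q) x = p (q x).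
Proof. by []. Qed.

End SymmetricGroup.

(** * The Cantor-Bernstein bijection *)

Section CantorBernstein.

Variables (T : Type) (f g : T -> T).

(** Chains starting outside the image of [g]: [cb_rel] follows [f] along them and [g] backwards
    elsewhere. *)
Definition cb_reach (x : T) : Prop :=
  exists n y, (forall z, g z <> y) /\ x = iter n (g \o f) y.

Definition cb_rel (x y : T) : Prop :=
  (cb_reach x /\ y = f x) \/ (~ cb_reach x /\ x = g y).

Hypotheses (finj : injective f) (ginj : injective g).

Lemma cb_reach_nim x : (forall z, g z <> x) -> cb_reach x.
Proof. by move=> xg; exists 0, x. Qed.

Lemma cb_rel_total x : exists y, cb_rel x y.
Proof.
have [rx|nrx] := EM (cb_reach x); first by exists (f x); left.
have [[z zx]|nz] := EM (exists z, g z = x); first by exists z; right.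
by case: nrx; apply: cb_reach_nim => z zx; apply: nz; exists z.
Qed.

Lemma cb_rel_surj y : exists x, cb_rel x y.
Proof.
(* If [g y] is reached, it is not at step 0, being in the image of [g]; cancelling [g] then exhibits
   [y] as [f] of a reached point. *)
have [[[|n] [y0 [y0g]]]|nr] := EM (cb_reach (g y)); last by exists (g y); right.
  by move=> /= /y0g.
rewrite iterS => /ginj yE; exists (iter n (g \o f) y0); left.
by split=> //; exists n, y0.
Qed.

Lemma cb_rel_fun x y y' : cb_rel x y -> cb_rel x y' -> y = y'.
Proof. by case=> [[rx ->]|[rx xE]] [[rx' ->]|[rx' x'E]] //; apply: ginj; rewrite -xE. Qed.

(** A mixed case would make some [g (f z)] unreached with [z] reached, but [cb_reach] is stable
    under [g \o f]. *)
Lemma cb_rel_inj x x' y : cb_rel x y -> cb_rel x' y -> x = x'.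
Proof.
have reachS z : cb_reach z -> cb_reach (g (f z)).
  by case=> n [y0 [y0g ->]]; exists n.+1, y0.
case=> [[rx yE]|[rx xE]] [[rx' yE']|[rx' xE']]; last by rewrite xE.
- by apply: finj; rewrite -yE.
- by case: rx'; rewrite xE' yE; apply: reachS.
- by case: rx; rewrite xE yE'; apply: reachS.
Qed.

Definition cb_fun x : T := sval (cid (cb_rel_total x)).
Definition cb_inv y : T := sval (cid (cb_rel_surj y)).

Lemma cb_funP x : cb_rel x (cb_fun x).
Proof. by rewrite /cb_fun; case: cid. Qed.

Lemma cb_invP y : cb_rel (cb_inv y) y.
Proof. by rewrite /cb_inv; case: cid. Qed.

Lemma cb_funK : cancel cb_fun cb_inv.
Proof. by move=> x; apply: cb_rel_inj (cb_invP _) (cb_funP _). Qed.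

Lemma cb_invK : cancel cb_inv cb_fun.
Proof. by move=> y; apply: cb_rel_fun (cb_funP _) (cb_invP _). Qed.

Definition cb_symm : symm T := Symm cb_funK cb_invK.

Lemma cb_symmP x : cb_rel x (cb_symm x).
Proof. exact: cb_funP. Qed.

(** Keeping the image of [g] away from given points thus prescribes the bijection there. *)
Lemma cb_symm_nim x : (forall z, g z <> x) -> cb_symm x = f x.
Proof.
move=> xg; apply: (@cb_rel_fun x); first exact: cb_symmP.
by left; split=> //; apply: cb_reach_nim.
Qed.

End CantorBernstein.

(** * Naturality of the Cantor-Bernstein bijection *)

Section CantorBernsteinTransport.

Variables (T : Type) (f g f' g' : T -> T) (a b : symm T).
Hypotheses (fab : forall x, f' (a x) = b (f x))
           (gab : forall x, g' (b x) = a (g x)).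

Lemma cb_reach_transport x : cb_reach f g x -> cb_reach f' g' (a x).
Proof.
case=> n [y [yg ->]]; exists n, (a y); split=> [z|].
  rewrite -(symm_invK b z) gab => /(can_inj (symm_funK a)); exact: yg.
by elim: n => //= n <-; rewrite fab gab.
Qed.

End CantorBernsteinTransport.

Lemma cb_symm_transport T (f g f' g' : T -> T) (a b : symm T)
    (fi : injective f) (gi : injective g)
    (fi' : injective f') (gi' : injective g') :
    (forall x, f' (a x) = b (f x)) -> (forall x, g' (b x) = a (g x)) ->
  forall x, cb_symm fi' gi' (a x) = b (cb_symm fi gi x).
Proof.
move=> fab gab x.
(* The inverses intertwine as well; this transports [cb_reach] back, as the negative case of
   [cb_rel] needs. *)
have fabV y : f (symm_opp a y) = symm_opp b (f' y).
  by apply: (can_inj (symm_funK b)); rewrite /= symm_invK -fab symm_invK.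
have gabV y : g (symm_opp b y) = symm_opp a (g' y).
  by apply: (can_inj (symm_funK a)); rewrite /= symm_invK -gab symm_invK.
apply: (cb_rel_fun gi'); first exact: cb_symmP.
have [[rx ->]|[rx xE]] := cb_symmP fi gi x.
  by left; split; [apply: cb_reach_transport rx|rewrite fab].
right; split; last by rewrite gab /= -xE.
by move/(cb_reach_transport fabV gabV); rewrite /= symm_funK.
Qed.

(** * Orbit representatives of a free action *)

Section FreeAction.

Variables (G : groupType) (T : choiceType) (act : G -> T -> T).
Hypotheses (act1 : forall x, act 1 x = x)
           (actM : forall g h x, act (g * h) x = act g (act h x))
           (free : forall g x, act g x = x -> g = 1).

Definition orbit_repr (x : T) : T :=
  choose (fun y => `[< exists g, y = act g x >]) x.

Lemma orbit_reprP x : exists g, x = act g (orbit_repr x).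
Proof.
have /asboolP[g ->] : `[< exists g, orbit_repr x = act g x >].
  apply: (@chooseP _ (fun y => `[< exists g, y = act g x >])).
  by apply/asboolP; exists 1.
by exists g^-1; rewrite -actM mulVg.
Qed.

Definition orbit_coord (x : T) : G := sval (cid (orbit_reprP x)).

Lemma orbit_coordE x : act (orbit_coord x) (orbit_repr x) = x.
Proof. by rewrite /orbit_coord; case: cid. Qed.

(** [x] and [act g x] define equivalent predicates, and [choose] returns the same point from any
    start satisfying the predicate. *)
Lemma orbit_repr_act g x : orbit_repr (act g x) = orbit_repr x.
Proof.
pose P y z := `[< exists h : G, z = act h y >].
have xx : P x x by apply/asboolP; exists 1.
have xgx : P x (act g x) by apply/asboolP; exists g.
rewrite /orbit_repr -(choose_id xgx xx); apply: eq_choose => y.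
apply: asbool_equiv_eq; split=> -[h ->]; first by exists (h * g); rewrite actM.
by exists (h * g^-1); rewrite -actM mulgVK.
Qed.

(** Both sides carry the representative to [act g x], and freeness leaves only one such group
    element. *)
Lemma orbit_coord_act g x : orbit_coord (act g x) = g * orbit_coord x.
Proof.
have kE : act (orbit_coord (act g x)) (orbit_repr x) =
    act (g * orbit_coord x) (orbit_repr x).
  by rewrite actM orbit_coordE -(orbit_repr_act g x) orbit_coordE.
apply: (mulgI (g * orbit_coord x)^-1); rewrite mulVg.
apply: (free (x := orbit_repr x)).
by rewrite actM kE -actM mulVg act1.
Qed.

End FreeAction.

(** * Permutations of [omega] attached to group elements and edges *)

Section Representation.

Variables (G : countGroupType) (E : digraph) (A : self_similar_action G E).
Hypothesis pf : pseudo_free A.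

(** Induction gives [phi A g e = 1] for the first edge [e]; pseudo-freeness at [e] concludes. *)
Lemma pseudo_free_seq g s :
  seq_act A g s = s -> seq_phi A g s = 1 -> g = 1.
Proof. by elim: s g => //= e s IHs g [ge /IHs{}IHs /IHs]; apply: pf. Qed.

(** The summand [G * nat] supplies infinitely many free orbits, room for any countable free
    [G]-set. *)
Definition omega : Type := ((seq (edge E) * G) + (G * nat))%type.

HB.instance Definition _ := Countable.on omega.

Definition omega_act (g : G) (x : omega) : omega :=
  match x with
  | inl (w, k) => inl (seq_act A g w, seq_phi A g w * k)
  | inr (k, n) => inr (g * k, n)
  end.

Lemma omega_act1 x : omega_act 1 x = x.
Proof.
by case: x => -[w k] /=; rewrite ?seq_act1 ?seq_phi1 mul1g.
Qed.

Lemma omega_actM g h x : omega_act (g * h) x = omega_act g (omega_act h x).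
Proof.
by case: x => -[w k] /=; rewrite ?seq_actM ?seq_phiM mulgA.
Qed.

Lemma omega_act_free g x : omega_act g x = x -> g = 1.
Proof.
case: x => [[w k]|[k n]] /= [].
  move=> gw gk; apply: pseudo_free_seq gw _.
  by apply: (mulIg k); rewrite mul1g.
by move=> gk; apply: (mulIg k); rewrite mul1g.
Qed.

Lemma omega_actK g : cancel (omega_act g) (omega_act g^-1).
Proof. by move=> x; rewrite -omega_actM mulVg omega_act1. Qed.

Lemma omega_actVK g : cancel (omega_act g^-1) (omega_act g).
Proof. by move=> x; rewrite -omega_actM mulgV omega_act1. Qed.

Definition omega_symm g : symm omega := Symm (omega_actK g) (omega_actVK g).

Lemma omega_symmM g h : omega_symm (g * h) = omega_symm g * omega_symm h.
Proof. by apply: symm_ext => x; apply: omega_actM. Qed.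

Lemma omega_symm1 : omega_symm 1 = 1.
Proof. by apply: symm_ext => x; apply: omega_act1. Qed.

Lemma omega_symmV g : omega_symm g^-1 = (omega_symm g)^-1.
Proof. by apply: (mulgI (omega_symm g)); rewrite -omega_symmM !mulgV omega_symm1. Qed.

(* An equivariant family [T_e] is the same as an isomorphism over [E^1] from
   [E^1 x Omega] with the action [twist_act] to [E^1 x Omega] with the action
   [diag_act]. *)
Definition twist_act (g : G) (ex : edge E * omega) : edge E * omega :=
  (eact A g ex.1, omega_act (phi A g ex.1) ex.2).
Definition diag_act (g : G) (ex : edge E * omega) : edge E * omega :=
  (eact A g ex.1, omega_act g ex.2).

Lemma twist_act1 x : twist_act 1 x = x.
Proof. by case: x => e x; rewrite /twist_act /= eact1 phi1 omega_act1. Qed.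

Lemma twist_actM g h x : twist_act (g * h) x = twist_act g (twist_act h x).
Proof. by rewrite /twist_act /= eactM phiM omega_actM. Qed.

Lemma twist_act_free g x : twist_act g x = x -> g = 1.
Proof. by case: x => e x [ge /omega_act_free]; apply: pf. Qed.

Lemma diag_act1 x : diag_act 1 x = x.
Proof. by case: x => e x; rewrite /diag_act /= eact1 omega_act1. Qed.

Lemma diag_actM g h x : diag_act (g * h) x = diag_act g (diag_act h x).
Proof. by rewrite /diag_act /= eactM omega_actM. Qed.

Lemma diag_act_free g x : diag_act g x = x -> g = 1.
Proof. by case: x => e x [_ /omega_act_free]. Qed.

Definition twist_repr := orbit_repr twist_act.
Definition twist_coord := orbit_coord twist_act1 twist_actM.
Definition diag_repr := orbit_repr diag_act.
Definition diag_coord := orbit_coord diag_act1 diag_actM.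

(** Off the words, the coordinate and the code of the representative embed the twisted action
    equivariantly into [G * nat]. *)
Definition twist_to_diag (e : edge E) (x : omega) : omega :=
  match x with
  | inl (w, k) => inl (e :: w, k)
  | inr _ => inr (twist_coord (e, x), pickle (twist_repr (e, x)))
  end.

(** Applying [phi] to the coordinate produces the factor [phi A g e] of the twisted action. All
    values lie in the second summand, so words stay outside the image. *)
Definition diag_to_twist (e : edge E) (x : omega) : omega :=
  let r := diag_repr (e, x) in
  inr (phi A (diag_coord (e, x)) r.1, pickle r).

Lemma diag_coordE x : diag_act (diag_coord x) (diag_repr x) = x.
Proof. exact: orbit_coordE. Qed.

Lemma twist_coordE x : twist_act (twist_coord x) (twist_repr x) = x.
Proof. exact: orbit_coordE. Qed.

Lemma eact_diag_coord e x :
  eact A (diag_coord (e, x)) (diag_repr (e, x)).1 = e.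
Proof. by have [] := diag_coordE (e, x). Qed.

Lemma pickle_inj (T : countType) : injective (@pickle T).
Proof. exact: pcan_inj (@pickleK T). Qed.

Lemma twist_to_diag_inj e : injective (twist_to_diag e).
Proof.
case=> [[w k]|c] [[w' k']|c'] //= [].
  by move=> -> ->.
move=> coordE /pickle_inj reprE.
have : (e, inr c : omega) = (e, inr c' : omega); last by case=> ->.
by rewrite -[LHS]twist_coordE -[RHS]twist_coordE coordE reprE.
Qed.

Lemma diag_to_twist_inj e : injective (diag_to_twist e).
Proof.
move=> x y [phiE /pickle_inj reprE].
have xE := eact_diag_coord e x; rewrite reprE in phiE xE.
have yE := eact_diag_coord e y.
have coordE : diag_coord (e, x) = diag_coord (e, y).
  (* Both coordinates send the edge of the common representative to [e] with equal [phi], so their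
     quotient fixes that edge with trivial [phi]. *)
  apply: (mulgI (diag_coord (e, y))^-1); rewrite mulVg.
  apply: (pf (e := (diag_repr (e, y)).1)).
    have := eact1 A (diag_repr (e, y)).1.
    by rewrite -[X in eact A X](mulVg (diag_coord (e, y))) !eactM xE yE.
  have := phi1 A (diag_repr (e, y)).1.
  by rewrite -[X in phi A X](mulVg (diag_coord (e, y))) !phiM phiE xE yE.
have : (e, x) = (e, y); last by case.
by rewrite -[LHS]diag_coordE -[RHS]diag_coordE coordE reprE.
Qed.

Lemma twist_to_diag_act g e x :
  twist_to_diag (eact A g e) (omega_act (phi A g e) x) =
  omega_act g (twist_to_diag e x).
Proof.
case: x => [[w k]|[k n]] //=.
rewrite -[(eact A g e, _)]/(twist_act g (e, inr (k, n))).
by rewrite /twist_coord /twist_repr orbit_coord_act ?orbit_repr_act //;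
   [apply: twist_act1|apply: twist_actM|apply: twist_act_free].
Qed.

Lemma diag_to_twist_act g e x :
  diag_to_twist (eact A g e) (omega_act g x) =
  omega_act (phi A g e) (diag_to_twist e x).
Proof.
rewrite /diag_to_twist -[(eact A g e, _)]/(diag_act g (e, x)).
rewrite /diag_repr (orbit_repr_act diag_act1 diag_actM).
rewrite /diag_coord (orbit_coord_act diag_act1 diag_actM diag_act_free) /=.
rewrite phiM; congr (inr (phi A g _ * _, _)).
exact: eact_diag_coord.
Qed.

Definition edge_symm (e : edge E) : symm omega :=
  cb_symm (@twist_to_diag_inj e) (@diag_to_twist_inj e).

Lemma edge_symm_word e w k : edge_symm e (inl (w, k)) = inl (e :: w, k).
Proof. exact: cb_symm_nim. Qed.

Lemma omega_edge_symm g e :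
  omega_symm g * edge_symm e = edge_symm (eact A g e) * omega_symm (phi A g e).
Proof.
apply: symm_ext => x; apply/esym.
(* The source carries the twisted action and the target the diagonal one, hence two different
   permutations. *)
apply: (@cb_symm_transport _ _ _ _ _ (omega_symm (phi A g e)) (omega_symm g)).
  exact: twist_to_diag_act.
exact: diag_to_twist_act.
Qed.

Definition word_symm (w : seq (edge E)) : symm omega :=
  foldr (fun e p => edge_symm e * p) 1 w.

Lemma word_symm_cat u v : word_symm (u ++ v) = word_symm u * word_symm v.
Proof. by elim: u => /= [|e u ->]; rewrite ?mul1g ?mulgA. Qed.

Lemma omega_word_symm g w :
  omega_symm g * word_symm w =
  word_symm (seq_act A g w) * omega_symm (seq_phi A g w).
Proof.
elim: w g => /= [|e w IHw] g; first by rewrite mulg1 mul1g.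
by rewrite mulgA omega_edge_symm -mulgA IHw mulgA.
Qed.

Lemma word_symm_word u w k : word_symm u (inl (w, k)) = inl (u ++ w, k).
Proof.
elim: u => // e u IHu.
by rewrite [word_symm _]/= symmM IHu edge_symm_word.
Qed.

Lemma word_omega_symm_inj u v g h :
  word_symm u * omega_symm g = word_symm v * omega_symm h -> u = v /\ g = h.
Proof.
move=> /(congr1 (fun p : symm omega => p (inl ([::], 1)))).
by rewrite !symmM /= !mulg1 !word_symm_word !cats0 => -[-> ->].
Qed.

(** * The idempotent pure prehomomorphism *)

Definition SGE_theta (s : SGE A) : symm omega :=
  if s is Some (Triple (a, g, b) _)
  then word_symm (path_edges a) * omega_symm g * (word_symm (path_edges b))^-1
  else 1.

Lemma SGE_theta_prehomomorphism : prehomomorphism SGE_theta.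
Proof.
case=> [[[[a g] b] p]|] // [[[[c h] n] q]|] //.
have [[c' [bc' cE]]|nc] := EM (exists c', path_d b = path_r c' /\ c = path_cat b c').
  subst c => _; rewrite [_ * _ in LHS](SGE_mul_r p bc' q) /=.
  have ac' : path_d a = path_r (path_act A g c').
    by rewrite path_r_act -bc'; apply/eqP.
  rewrite !path_edges_cat // !word_symm_cat omega_symmM !mulgA.
  rewrite mulgVK -(mulgA _ (omega_symm g)) omega_word_symm.
  by rewrite !mulgA.
have [[b' [cb' bE]]|nb] := EM (exists b', path_d c = path_r b' /\ b = path_cat c b').
  subst b => _; rewrite [_ * _ in LHS](SGE_mul_l p cb' q) /=.
  have nb' : path_d n = path_r (path_act A h^-1 b').
    by rewrite path_r_act -cb'; apply: vactK; apply/eqP.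
  rewrite !path_edges_cat // !word_symm_cat omega_symmM omega_symmV !invgM.
  (* Writing [h] as the inverse of [h^-1] brings in the exchange rule for [h^-1] and [b'],
     inverted. *)
  rewrite !mulgA mulgVK -[in RHS](invgK h) [in RHS]omega_symmV.
  rewrite -!(mulgA (word_symm (path_edges a) * omega_symm g)).
  congr (_ * _); congr (_ * _).
  by rewrite -[RHS]invgM omega_word_symm invgM.
by rewrite [_ * _](SGE_mul_0 p q nc nb).
Qed.

(** Such an element acts as a partial identity, and [SGE_act] is faithful. *)
Lemma SGE_diag_idempotent (s : triple A) :
  (val s).1.1 = (val s).2 -> (val s).1.2 = 1 -> idempotent (Some s : SGE A).
Proof.
case: s => -[[a g] b] p /= ab g1; subst b g; rewrite /idempotent.
have sid x y : SGE_act (Some (Triple p)) x = Some y -> x = y.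
  case/(@triple_actP _ _ A) => w -> ->; rewrite seq_act1 seq_phi1 mul1g.
  by [].
apply: SGE_act_inj => x; rewrite [LHS]SGE_actM.
case sx: (SGE_act _ x) => [y|] //.
by have xy := sid _ _ sx; subst y.
Qed.

Lemma SGE_theta_idempotent_pure : idempotent_pure SGE_theta.
Proof.
move=> s s0; split=> [|ss]; last first.
  apply: (mulgI (SGE_theta s)); rewrite mulg1 -SGE_theta_prehomomorphism ss //.
case: s s0 => [[[[a g] b] p]|] // _ /= th1.
have [] : path_edges a = path_edges b /\ g = 1.
  apply: word_omega_symm_inj; apply: (mulIg (word_symm (path_edges b))^-1).
  by rewrite th1 omega_symm1 mulg1 mulgV.
move=> ab g1; apply: SGE_diag_idempotent => //=.
apply: val_inj => /=; rewrite [LHS]surjective_pairing [RHS]surjective_pairing.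
rewrite -/(path_edges a) -/(path_edges b) ab; congr pair.
(* The base vertices must agree too: a first edge determines them, and for empty words the condition
   [p] equates them. *)
have := fpath_chain a; have := fpath_chain b.
rewrite -/(path_edges a) -/(path_edges b) ab.
move/eqP: p; rewrite /= g1 vact1 /path_d ab /path_r.
by case: (path_edges b) => //= e w _ /andP[/eqP <- _] /andP[/eqP <- _].
Qed.

End Representation.

(** * Necessity of pseudo-freeness, and the equivalence *)

Lemma strongly_Estar_unitary_pseudo_free (G : countGroupType) (E : digraph)
    (A : self_similar_action G E) :
  strongly_Estar_unitary (SGE A) -> pseudo_free A.
Proof.
case=> H [theta [thM thI]] g e ge phie.
have gr : edge_r e = vact A g (edge_r e).
  by have [_ _ <- _] := act_aut A g; rewrite ge.
have ps : in_SGE A (vpath (edge_r e), g, vpath (edge_r e)) by apply/eqP.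
have pt : in_SGE A (epath e, 1, epath e) by apply/eqP; rewrite /= vact1.
pose s : SGE A := Some (Triple ps); pose t : SGE A := Some (Triple pt).
have st : s * t = t.
  apply: SGE_act_inj => x; rewrite [LHS]SGE_actM.
  case tx: (SGE_act t x) => [y|] //=.
  have [w _ ->] := triple_actP tx.
  by rewrite /= eqxx ge phie !seq_act1 !seq_phi1 !mul1g.
have tt : theta t = 1.
  by apply/thI => //; apply: SGE_diag_idempotent.
have ss : idempotent s.
  by apply/thI => //; have := thM s t; rewrite st tt mulg1 => <-.
(* The idempotent [s] acts as a partial identity, yet turns the group component [1] into [g]. *)
have := @SGE_idem_act _ _ A s ((edge_r e, [::]), 1) ((edge_r e, [::]), g) ss.
by rewrite /= eqxx mulg1 => /(_ erefl) [].
Qed.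

Theorem theorem3p3 (G : countGroupType) (E : digraph)
    (A : self_similar_action G E) :
  strongly_Estar_unitary (SGE A) <-> pseudo_free A.
Proof.
split=> [|pf]; first exact: strongly_Estar_unitary_pseudo_free.
exists (symm (omega G E)), (SGE_theta pf); split.
  exact: SGE_theta_prehomomorphism.
exact: SGE_theta_idempotent_pure.
Qed.
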